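(* Let $X$ be a $q$-homogeneous tree with $q\ge 2$ and origin $o$, let $\sigma$ be a reference measure on $X$, and let $K$ be the reproducing kernel of the harmonic Bergman space $\mathcal{A}^2(\sigma)$. For every $(z,x)\in X\times X$, $$K(z,x)=\frac{1}{B_\sigma}+\frac{q^2}{(q-1)^2}\sum_{v\in X}\frac{1}{b_{|v|}}\,\Gamma(v,z,x)\,(1-q^{|v|-|z|})(1-q^{|v|-|x|}).$$
   Context: A $q$-homogeneous tree $X$ ($q\ge 2$ an integer) is an undirected connected cycle-free graph in which every vertex has exactly $q+1$ neighbours; $X$ also denotes its vertex set, $d$ is the graph distance, $u\sim v$ means $u,v$ are adjacent, $o\in X$ is a fixed origin and $|x|=d(o,x)$. $[o,x]$ is the unique path from $o$ to $x$ (endpoints included). The sector of $v\neq o$ is $T_v=\{x\in X: [o,v]\subseteq[o,x]\}$, and $T_o=X$. The set of successors of $v$ is $s(v)=\{u\sim v: |u|=|v|+1\}$, so $\# s(o)=q+1$ and $\# s(v)=q$ for $v\ne o$. A function $f:X\to\mathbb{C}$ is harmonic if $f(v)=\frac1{q+1}\sum_{u\sim v}f(u)$ for every $v\in X$. A reference measure on $X$ is a finite measure which is absolutely continuous with respect to the counting measure, with density (also denoted $\sigma$) a strictly positive, radial (depending only on $|x|$) function that is decreasing in $|x|$; $\sigma_n$ is the value of $\sigma$ on $\{|x|=n\}$ and $B_\sigma=\sum_{x\in X}\sigma(x)<\infty$. $\mathcal{A}^2(\sigma)$ is the Hilbert space of harmonic functions $f$ with $\sum_{x}|f(x)|^2\sigma(x)<\infty$,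 with scalar product $\langle f,g\rangle_{\mathcal{A}^2(\sigma)}=\sum_{x\in X}f(x)\overline{g(x)}\sigma(x)$. It is a reproducing kernel Hilbert space: for each $z\in X$ there is a unique $K_z\in\mathcal{A}^2(\sigma)$ with $\langle g,K_z\rangle_{\mathcal{A}^2(\sigma)}=g(z)$ for all $g\in\mathcal{A}^2(\sigma)$, and $K(z,x):=K_z(x)$. For $n\in\mathbb{N}=\{0,1,2,\dots\}$ put $a_n=\sum_{j=0}^n q^{-j}$ and $$b_n=\sum_{m=n+1}^{\infty}\sigma_m\,a_{m-n-1}\Big(\sum_{k=0}^{m-n-1}q^k\Big).$$ For $(v,z,x)\in X^3$: $\Gamma(v,z,x)=0$ if $\{z,x\}\not\subseteq T_v\setminus\{v\}$; $\Gamma(v,z,x)=\frac{\# s(v)-1}{\# s(v)}$ if $\{z,x\}\subseteq T_y$ for some $y\in s(v)$; $\Gamma(v,z,x)=-\frac1{\# s(v)}$ otherwise. (For fixed $z,x$ only finitely many $v$ give $\Gamma(v,z,x)\neq0$.) *)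

(* Defs.v *)
From mathcomp Require Import all_boot all_order all_algebra finmap.
From mathcomp Require Import all_classical reals ereal sequences numfun esum.
From mathcomp.real_closed Require Import complex.

Set Implicit Arguments.
Unset Strict Implicit.
Unset Printing Implicit Defensive.
Import Order.TTheory GRing.Theory Num.Theory.

Local Open Scope classical_set_scope.
Local Open Scope complex_scope.
Local Open Scope ring_scope.

(* A graph on the vertex set X is its adjacency relation e : rel X. *)

Section Tree.
Variables (X : choiceType) (e : rel X).

(* [tree_acyclic]: [ucycle e c] is a closed walk through pairwise distinct
   vertices; those of size 2 merely go back and forth along one edge, so the
   genuine cycles are those of size at least 3. *)
Record homogeneous_tree (q : nat) : Prop := HomogeneousTree {
  tree_sym : symmetric e;
  tree_irrefl : irreflexive e;
  tree_connected : forall x y, exists2 p, path e x p & last x p = y;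
  tree_acyclic : forall c, ucycle e c -> (size c <= 2)%N;
  tree_degree : forall v, ([set u | e v u] #= `I_q.+1)%card }.

Definition walk (x y : X) (n : nat) : Prop :=
  exists p, [/\ path e x p, last x p = y & size p = n].

Definition dist (x y : X) : nat :=
  xget 0%N [set n | walk x y n /\ forall m, walk x y m -> (n <= m)%N].

(* The vertices of [x, y]; in a tree there is exactly one simple path p. *)
Definition segment (x y : X) : set X :=
  [set w | exists p, [/\ path e x p, uniq (x :: p), last x p = y
                       & w \in x :: p]].

Variable o : X.

Definition level (x : X) : nat := dist o x.

Definition sector (v : X) : set X :=
  [set x | segment o v `<=` segment o x].

Definition succs (v : X) : set X :=
  [set u | e v u /\ level u = (level v).+1].

Definition nsuccs (v : X) : nat := #|` fset_set (succs v)|.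

Definition Gamma (R : realType) (v z x : X) : R :=
  if ~~ `[< [set z; x] `<=` sector v `\ v >] then 0
  else if `[< exists2 y, succs v y & [set z; x] `<=` sector y >]
  then ((nsuccs v)%:R - 1) / (nsuccs v)%:R
  else - (nsuccs v)%:R^-1.

End Tree.

Section Sums.
Variables (R : realType) (T : choiceType).

(* Sums of absolutely summable families. [\esum] is a supremum over finite
   subsets, hence the sum only for nonnegative terms, so a real family is split
   into its positive and negative parts. *)
Definition rsum (f : T -> R) : R :=
  fine (\esum_(x in [set: T]) ((EFin \o f)^\+)%E x)
  - fine (\esum_(x in [set: T]) ((EFin \o f)^\-)%E x).

Definition csum (f : T -> R[i]) : R[i] :=
  rsum (fun x => complex.Re (f x)) +i* rsum (fun x => complex.Im (f x)).

End Sums.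

Section Bergman.
Variables (R : realType) (X : choiceType) (e : rel X) (q : nat) (o : X).

Definition harmonic_fun (f : X -> R[i]) : Prop :=
  forall v, f v = (q.+1%:R)^-1 * \sum_(u \in [set u | e v u]) f u.

(* A measure on X is given by its density with respect to the counting measure;
   "decreasing" is read in the wide sense. *)
Record reference_measure (sigma : X -> R) : Prop := ReferenceMeasure {
  ref_gt0 : forall x, 0 < sigma x;
  ref_radial : forall x y, level e o x = level e o y -> sigma x = sigma y;
  ref_decreasing : forall x y, (level e o x <= level e o y)%N ->
    sigma y <= sigma x;
  ref_finite : (\esum_(x in [set: X]) (sigma x)%:E < +oo)%E }.

Variable sigma : X -> R.

Definition sigma_at (n : nat) : R := sigma (xget o [set x | level e o x = n]).

Definition total_mass : R := fine (\esum_(x in [set: X]) (sigma x)%:E).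

Definition bergman (f : X -> R[i]) : Prop :=
  harmonic_fun f /\
  (\esum_(x in [set: X]) ((Normc.normc (f x)) ^+ 2 * sigma x)%:E
   < +oo)%E.

Definition inner (f g : X -> R[i]) : R[i] :=
  csum (fun x => f x * (g x)^* * (sigma x)%:C).

(* [K z] is the function K_z, so that [K z x] is K(z, x) = K_z(x). *)
Definition reproducing_kernel (K : X -> X -> R[i]) : Prop :=
  forall z, bergman (K z) /\ forall g, bergman g -> inner g (K z) = g z.

Definition a_ (n : nat) : R := \sum_(0 <= j < n.+1) (q%:R ^+ j)^-1.

Definition b_ (n : nat) : R :=
  fine (\sum_(n.+1 <= m <oo)
    (sigma_at m * a_ (m - n - 1)%N
     * \sum_(0 <= k < (m - n - 1).+1) q%:R ^+ k)%:E)%E.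

End Bergman.

(* Main.v *)
Require Import Defs.
From mathcomp Require Import all_boot all_order all_algebra finmap.
From mathcomp Require Import all_classical reals ereal sequences numfun esum.
From mathcomp.real_closed Require Import complex.
From mathcomp Require Import ring lra topology normedtype.

Set Implicit Arguments.
Unset Strict Implicit.
Unset Printing Implicit Defensive.
Import Order.TTheory GRing.Theory Num.Theory.
Import numFieldNormedType.Exports.
Local Open Scope classical_set_scope.
Local Open Scope complex_scope.
Local Open Scope ring_scope.

(** Let k_z denote the right-hand side, as a function of x. It is enough to show
    that k_z lies in the Bergman space and that <g, k_z> = g(z) for every g in it:
    evaluating <K_z, k_x> in two ways then identifies K_z(x) with k_x(z) = k_z(x).
    As k_z and sigma are real, real and imaginary parts of g can be treated
    separately, so g is replaced by a real harmonic function u.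

    The sum over v only involves the strict ancestors v of z. For such a v, with
    c its child towards z, the function
    phi_v(x) = Gamma(v, z, x) (1 - q^(|v| - |x|)) is harmonic and bounded by 1
    ([branch_harmonic], [branch_le1]): Gamma(v, z, .) has mean zero on the
    children of v and is constant on the sector of each of them, and 1 - q^(-m)
    solves the radial equation. Hence k_z is harmonic and bounded, and it is in
    the Bergman space because sigma is finite.

    To compute <u, phi_v>, let A(n) be the sum of Gamma(v, z, x) u(x) over
    |x| = n. Harmonicity of u gives A(n + 2) = (q + 1) A(n + 1) - q A(n) for
    n >= |v|, with A(|v|) = 0, so that A(|v| + m) is (1 + q + ... + q^(m-1)) times
    A(|v| + 1), the difference between u(c) and the mean of u on the successors of
    v ([sphere_pairingE]). Summing against sigma over the spheres gives
    <u, phi_v> = (1 - 1/q) b_|v| (u(c) - mean), which is where the constants b come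
    from ([ball_sum_branch], [b_cvg]).

    Finally u(c) - mean equals (u(c) - u(v)) - (u(v) - u(par v)) / q, and with the
    weights 1 - q^(|v| - |z|) these quantities telescope along the path from o to
    z ([oscillationE], [telescoping]): the sum over v contributes u(z) - u(o), and
    the constant 1 / B contributes u(o) by the mean value property. *)

(** * The tree as a rooted tree *)

Section RootedTree.
Variables (X : choiceType) (e : rel X) (q : nat).
Hypothesis hX : homogeneous_tree e q.
Variable o : X.

Local Notation lvl := (level e o).

Lemma level_spec x :
  walk e o x (lvl x) /\ forall m, walk e o x m -> (lvl x <= m)%N.
Proof.
have [p pp lp] := tree_connected hX o x.
have ex : exists n, `[< walk e o x n >].
  by exists (size p); apply/asboolP; exists p.
rewrite /level /dist; set S := [set n | _ /\ _].
suff : S (xget 0%N S) by [].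
apply: xgetPex; exists (ex_minn ex).
case: ex_minnP => m /asboolP wm hm; split=> // k wk.
by apply: hm; apply/asboolP.
Qed.

Lemma level_walk x : walk e o x (lvl x).
Proof. by have [] := level_spec x. Qed.

Lemma level_min x n : walk e o x n -> (lvl x <= n)%N.
Proof. by have [_] := level_spec x; exact. Qed.

Lemma level_root : lvl o = 0%N.
Proof. by apply/eqP; rewrite -leqn0; apply: level_min; exists [::]. Qed.

Lemma level_eq0 x : (lvl x == 0%N) = (x == o).
Proof.
apply/eqP/eqP => [h|->]; last exact: level_root.
have [[|y p] [_ /= lp sp]] := level_walk x; last by rewrite h in sp.
by [].
Qed.

Lemma level_edge x y : e x y -> (lvl y <= (lvl x).+1)%N.
Proof.
move=> exy; have [p [pp lp sp]] := level_walk x.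
apply: level_min; exists (rcons p y).
by rewrite rcons_path pp lp exy last_rcons size_rcons sp.
Qed.

Lemma lower_neighbour x : x != o -> exists2 u, e x u & lvl x = (lvl u).+1.
Proof.
move=> xo; have [p [pp lp sp]] := level_walk x.
case/lastP: p => [|p y] in pp lp sp *.
  by move: xo; rewrite -lp eqxx.
rewrite last_rcons in lp; rewrite {y}lp in pp sp.
move: pp; rewrite rcons_path => /andP[pp exy]; exists (last o p).
  by rewrite (tree_sym hX).
apply/eqP; rewrite eqn_leq (level_edge exy) /= -sp size_rcons ltnS.
by apply: level_min; exists p.
Qed.

Lemma descent x : exists p,
  [/\ path e x p, last x p = o & all (fun w => lvl w < lvl x)%N p].
Proof.
have [n] := ubnP (lvl x); elim: n x => // n IHn x; rewrite ltnS => lx.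
have [->|xo] := eqVneq x o; first by exists [::].
have [u exu lu] := lower_neighbour xo.
have [|p [pp lp ap]] := IHn u; first by rewrite -lu.
exists (u :: p); split=> //=; first by rewrite exu.
rewrite lu ltnSn; by apply: sub_all ap => w /ltnW; rewrite ltnS.
Qed.

(** The descents from two distinct such neighbours to the root avoid v, since
    they only meet levels at most |v|, and strictly smaller ones after their
    first vertex. Joined at the root and made simple, they close up through v
    to a cycle of length at least 3. Hence neighbours cannot lie on the same
    level, and v has a single neighbour below it. *)
Lemma unique_lower_neighbour v u w : e v u -> e v w ->
  (lvl u <= lvl v)%N -> (lvl w <= lvl v)%N -> u = w.
Proof.
move=> evu evw lu lw; apply/eqP/negPn/negP => uw.
have neq x : e v x -> x != v.
  by move=> evx; apply: contraTneq evx => ->; rewrite (tree_irrefl hX).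
have [p [pp lp ap]] := descent u; have [r [pr lr ar]] := descent w.
pose t := p ++ rev (belast w r).
have pt : path e u t.
  rewrite cat_path pp lp -lr rev_path.
  by under eq_path do rewrite (tree_sym hX).
have lt : last u t = w.
  rewrite last_cat lp -lr.
  have -> : last (last w r) (rev (belast w r)) = last w (rev (w :: r)).
    by rewrite [w :: r]lastI rev_rcons.
  by rewrite rev_cons last_rcons.
have vt : v \notin u :: t.
  rewrite inE mem_cat mem_rev !negb_or eq_sym neq //=; apply/andP; split.
    by apply/negP => /(allP ap); rewrite ltnNge lu.
  apply/negP => /mem_belast; rewrite inE eq_sym (negPf (neq _ evw)) /=.
  by move=> /(allP ar); rewrite ltnNge lw.
case/shortenP: pt lt vt => s ps us sub ls vs.
have : ucycle e (v :: u :: s).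
  rewrite /ucycle /= evu rcons_path ps ls (tree_sym hX) evw /= -/(uniq (u :: s)).
  rewrite us andbT; apply: contra vs; rewrite !inE => /orP[->//|/sub ->].
  by rewrite orbT.
move/(tree_acyclic hX); case: s ps us sub ls => //= _ _ _ uw'.
by rewrite uw' eqxx in uw.
Qed.

(** The root is its own parent: iterates of [par] are then total, and formulas
    involving a grandparent remain meaningful near the root. *)
Definition par (v : X) : X :=
  if v == o then o else xget o [set u | e v u /\ lvl v = (lvl u).+1].

Lemma par_root : par o = o. Proof. by rewrite /par eqxx. Qed.

Lemma parP v : v != o -> e v (par v) /\ lvl v = (lvl (par v)).+1.
Proof.
move=> vo; have [u eu lu] := lower_neighbour vo.
rewrite /par (negPf vo).
by apply: (@xgetPex _ o [set u | e v u /\ lvl v = (lvl u).+1]); exists u.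
Qed.

Lemma level_par v : lvl (par v) = (lvl v).-1.
Proof.
have [->|/parP[_ ->] //] := eqVneq v o.
by rewrite par_root level_root.
Qed.

Lemma level_iter_par k v : lvl (iter k par v) = (lvl v - k)%N.
Proof. by elim: k => [|k IHk] /=; rewrite ?subn0// level_par IHk subnS. Qed.

(** From here on the graph is used only through [par], the level and the
    children. *)
Lemma edgeP v u : e v u = ((v != o) && (u == par v)) || ((u != o) && (par u == v)).
Proof.
apply/idP/orP => [evu|[/andP[vo /eqP ->]|/andP[uo /eqP <-]]]; last 2 first.
- by have [] := parP vo.
- by rewrite (tree_sym hX); have [] := parP uo.
have down a b : e a b -> (lvl b <= lvl a)%N -> (a != o) && (b == par a).
  move=> eab lab; have ao : a != o.
    apply: contraTneq eab => a0; move: lab; rewrite a0 level_root leqn0 level_eq0.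
    by move=> /eqP ->; rewrite (tree_irrefl hX).
  have [ea la] := parP ao; rewrite ao; apply/eqP.
  by apply: (unique_lower_neighbour eab ea lab); rewrite level_par leq_pred.
have [luv|lvu] := leqP (lvl u) (lvl v); first by left; apply: down.
by right; rewrite [par u == v]eq_sym; apply: down (ltnW lvu); rewrite (tree_sym hX).
Qed.

Lemma succsE v : succs e o v = [set u | (u != o) && (par u == v)].
Proof.
apply/seteqP; split=> u /=.
  move=> [evu lu]; have [//|up] := boolP (_ && _).
  move: evu; rewrite edgeP (negPf up) orbF => /andP[vo /eqP uv].
  by move: lu; rewrite uv level_par => h; have := leq_pred (lvl v); rewrite h ltnn.
by move=> /andP[uo /eqP <-]; rewrite /succs /= (tree_sym hX); have [] := parP uo.
Qed.

Lemma finite_neighbours v : finite_set [set u | e v u].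
Proof. by exists q.+1; exact: tree_degree hX v. Qed.

Lemma finite_succs v : finite_set (succs e o v).
Proof. by apply: sub_finite_set (finite_neighbours v) => u []. Qed.

Definition children (v : X) : seq X := enum_fset (fset_set (succs e o v)).

Lemma mem_children v u : (u \in children v) = (u != o) && (par u == v).
Proof.
have -> : (u \in children v) = (u \in fset_set (succs e o v)) by [].
rewrite in_fset_set; last exact: finite_succs.
by rewrite succsE; apply/idP/idP; rewrite inE.
Qed.

Lemma children_uniq v : uniq (children v).
Proof. exact: fset_uniq. Qed.

Lemma size_children v : size (children v) = nsuccs e o v.
Proof. by []. Qed.

Definition neighbours (v : X) : seq X :=
  if v == o then children v else par v :: children v.

Lemma mem_neighbours v u : (u \in neighbours v) = e v u.
Proof.
rewrite edgeP /neighbours; case: eqVneq => [->|vo]; first by rewrite mem_children.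
by rewrite inE mem_children.
Qed.

Lemma neighbours_uniq v : uniq (neighbours v).
Proof.
rewrite /neighbours; case: eqVneq => [->|vo]; first exact: children_uniq.
rewrite /= children_uniq mem_children andbT negb_and negbK; apply/orP; right.
apply/eqP => /(congr1 lvl); rewrite !level_par.
have [_] := parP vo; rewrite level_par; case: (lvl v) => // n _ /= h.
by have := leq_pred n; rewrite h ltnn.
Qed.

Lemma neighboursE v : [set u | e v u] = [set` neighbours v].
Proof. by apply/seteqP; split=> u /=; rewrite mem_neighbours. Qed.


Lemma size_neighbours v : size (neighbours v) = q.+1.
Proof.
have := tree_degree hX v; rewrite neighboursE => /card_fset_set.
have -> : fset_set [set` neighbours v] = [fset x in neighbours v]%fset.
  by apply/fsetP => x; rewrite in_fset_set ?finite_seq// !inE /= mem_setE.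
by rewrite card_fseq undup_id ?neighbours_uniq.
Qed.

Lemma nsuccs_root : nsuccs e o o = q.+1.
Proof. by rewrite -size_children -(size_neighbours o) /neighbours eqxx. Qed.

Lemma nsuccs_other v : v != o -> nsuccs e o v = q.
Proof.
move=> vo; apply: succn_inj; rewrite -size_children -(size_neighbours v).
by rewrite /neighbours (negPf vo).
Qed.

Lemma nsuccs_ge v : (q <= nsuccs e o v)%N.
Proof.
by have [->|vo] := eqVneq v o; rewrite ?nsuccs_root ?nsuccs_other.
Qed.

Fixpoint sphere (n : nat) : seq X :=
  if n is n'.+1 then flatten [seq children p | p <- sphere n'] else [:: o].

Lemma mem_sphere n x : (x \in sphere n) = (lvl x == n).
Proof.
elim: n x => [|n IHn] x /=; first by rewrite inE level_eq0.
apply/flatten_mapP/eqP => [[p]|lx].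
  rewrite IHn mem_children => /eqP <- /andP[xo /eqP <-].
  by have [] := parP xo.
have xo : x != o by rewrite -level_eq0 lx.
exists (par x); first by rewrite IHn level_par lx.
by rewrite mem_children xo /=.
Qed.

Lemma sphere_uniq n : uniq (sphere n).
Proof.
elim: n => //= n; elim: (sphere n) => //= p s IHs /andP[ps us].
rewrite cat_uniq children_uniq IHs // andbT /=; apply/hasPn => x.
move=> /flatten_mapP[p' p's]; rewrite !mem_children => /andP[xo /eqP xp'].
by rewrite xo xp'; apply: contraNneq ps => <-.
Qed.

Lemma big_sphereS (V : nmodType) n (F : X -> V) :
  \sum_(x <- sphere n.+1) F x = \sum_(p <- sphere n) \sum_(x <- children p) F x.
Proof. by rewrite /= big_flatten big_map. Qed.

(** A simple path from the root can only go up: its first edge does, and a later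
    edge going down would return to the vertex just visited. *)
Lemma simple_path_par p y : path e o (rcons p y) -> uniq (o :: rcons p y) ->
  y != o /\ last o p = par y.
Proof.
elim/last_ind: p y => [|p a IHp] y; rewrite rcons_path ?last_rcons.
  by rewrite /= edgeP eqxx /= => /andP[yo /eqP ->] _.
move=> /andP[pp ey]; rewrite -rcons_cons rcons_uniq => /andP[yp up].
have [ao la] := IHp _ pp up.
move: ey; rewrite edgeP => /orP[/andP[_ /eqP ya]|/andP[yo /eqP ->]] //.
by move: yp; rewrite ya -la -rcons_cons mem_rcons inE mem_last orbT.
Qed.

Lemma mem_simple_path p w : path e o p -> uniq (o :: p) ->
  (w \in o :: p) <-> exists k, iter k par (last o p) = w.
Proof.
elim/last_ind: p => [|p y IHp] pp up.
  have it k : iter k par o = o by elim: k => //= k ->; exact: par_root.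
  rewrite inE /=; split=> [/eqP ->|[k]]; first by exists 0%N.
  by rewrite it => ->.
have [_ lp] := simple_path_par pp up.
move: pp up; rewrite rcons_path -rcons_cons rcons_uniq => /andP[pp _] /andP[_ up].
have {IHp} := IHp pp up; rewrite lp => IHp.
rewrite mem_rcons inE last_rcons; split=> [/orP[/eqP ->|/IHp[k kw]]|[[|k] kw]].
- by exists 0%N.
- by exists k.+1; rewrite iterSr.
- by rewrite -kw eqxx.
- by apply/orP; right; apply/IHp; exists k; rewrite -iterSr.
Qed.

Lemma segmentE x w : segment e o x w <-> exists k, iter k par x = w.
Proof.
split=> [[p [pp up lp /(mem_simple_path _ pp up)]]|]; first by rewrite lp.
have [p pp lp] := tree_connected hX o x; move: lp.
case/shortenP: pp => s ps us _ ls; rewrite -ls => /(mem_simple_path _ ps us) ws.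
by exists s.
Qed.

Lemma sectorE v x : sector e o v x <-> exists k, iter k par x = v.
Proof.
split=> [sv|[k <-] w /segmentE[j <-]].
  by apply/segmentE/sv/segmentE; exists 0%N.
by apply/segmentE; exists (j + k)%N; rewrite iterD.
Qed.

Lemma sector_refl v : sector e o v v.
Proof. by apply/sectorE; exists 0%N. Qed.

Lemma sector_par v x : sector e o v x <-> x = v \/ sector e o v (par x).
Proof.
split=> [/sectorE[[|k] <-]|[->|/sectorE[k <-]]].
- by left.
- by right; apply/sectorE; exists k; rewrite iterSr.
- exact: sector_refl.
- by apply/sectorE; exists k.+1; rewrite iterSr.
Qed.

Lemma sector_level v x : sector e o v x -> x = v \/ (lvl v < lvl x)%N.
Proof.
move=> /sectorE[k <-]; rewrite level_iter_par.
case: k => [|k]; first by left.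
have [->|xo] := eqVneq x o.
  by left; elim: k.+1 => //= n <-; rewrite par_root.
by right; rewrite ltn_subrL /= lt0n level_eq0.
Qed.

End RootedTree.

(** * Harmonic functions on spheres *)

Section Harmonic.
Variables (R : realType) (X : choiceType) (e : rel X) (q : nat).
Hypothesis hX : homogeneous_tree e q.
Hypothesis hq : (2 <= q)%N.
Variable o : X.

Local Notation lvl := (level e o).
Local Notation par := (par e o).
Local Notation children := (children e o).
Local Notation sphere := (sphere e o).
Local Notation sector := (sector e o).
Local Notation Q := (q%:R : R).
Local Notation Gam := (Gamma e o R).

Lemma q_gt0 : 0 < Q. Proof. by rewrite ltr0n; apply: leq_trans hq. Qed.
Lemma q_neq0 : Q != 0. Proof. by rewrite gt_eqF ?q_gt0. Qed.
Lemma q_gt1 : 1 < Q. Proof. by rewrite ltr1n. Qed.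

Lemma sum_neighbours v (F : X -> R) : \sum_(u <- neighbours e o v) F u =
  (if v == o then 0 else F (par v)) + \sum_(u <- children v) F u.
Proof.
by rewrite /neighbours; case: eqP => _; rewrite ?add0r ?big_cons.
Qed.

Definition real_harmonic (u : X -> R) : Prop :=
  forall v, q.+1%:R * u v = \sum_(y <- neighbours e o v) u y.

(** Harmonicity at p writes the sum of u over the children of p as
    (q + 1) u(p) - u(par p); summed over a sphere against weights that children
    inherit from their parent, this is a three-term recursion. *)
Lemma sphere_recursion u (C : X -> R) n : real_harmonic u ->
  (forall p y, p \in sphere n.+1 -> y \in children p -> C y = C p) ->
  \sum_(x <- sphere n.+2) C x * u x =
  q.+1%:R * (\sum_(x <- sphere n.+1) C x * u x)
  - \sum_(r <- sphere n) (\sum_(p <- children r) C p) * u r.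
Proof.
move=> hu hC.
have -> : \sum_(r <- sphere n) (\sum_(p <- children r) C p) * u r =
    \sum_(p <- sphere n.+1) C p * u (par p).
  rewrite big_sphereS; apply: eq_bigr => r _; rewrite mulr_suml big_seq.
  rewrite [RHS]big_seq; apply: eq_bigr => p.
  by rewrite (mem_children hX) => /andP[_ /eqP ->].
rewrite mulr_sumr -sumrB big_sphereS !big_seq; apply: eq_bigr => p pn.
rewrite big_seq; under eq_bigr => y yp do rewrite (hC p)//.
rewrite -mulr_sumr -big_seq mulrCA -mulrBr hu sum_neighbours.
have : p != o by rewrite -(level_eq0 hX); move: pn; rewrite (mem_sphere hX) => /eqP ->.
by move=> /negPf ->; rewrite addrC addKr.
Qed.

(** Mean value property. Constants are harmonic, so the sums of u and the
    cardinalities of the spheres satisfy the same recursion (weights 1), and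
    it suffices to compare them on the first two spheres. *)
Lemma sphere_sum_harmonic u n : real_harmonic u ->
  \sum_(x <- sphere n) u x = (size (sphere n))%:R * u o.
Proof.
have rec w k : real_harmonic w -> \sum_(x <- sphere k.+2) w x =
    q.+1%:R * (\sum_(x <- sphere k.+1) w x)
    - (q + (k == 0))%:R * \sum_(x <- sphere k) w x.
  move=> hw; have := @sphere_recursion w (fun=> 1) k hw (fun _ _ _ _ => erefl).
  under eq_bigr do rewrite mul1r; under [X in _ * X]eq_bigr do rewrite mul1r.
  move=> ->; congr (_ - _); rewrite mulr_sumr !big_seq; apply: eq_bigr => r.
  rewrite (mem_sphere hX) => /eqP rk; congr (_ * _).
  rewrite big_const_seq count_predT iter_addr_0 size_children.
  case: k rk => [|k] rk; last by rewrite addn0 (nsuccs_other hX)// -(level_eq0 hX) rk.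
  by move/eqP: rk; rewrite (level_eq0 hX) => /eqP ->; rewrite (nsuccs_root hX) addn1.
move=> hu; have h1 : real_harmonic (fun=> 1).
  by move=> v; rewrite big_const_seq count_predT iter_addr_0 (size_neighbours hX) mulr1.
have sz k : (size (sphere k))%:R = \sum_(x <- sphere k) (1 : R).
  by rewrite big_const_seq count_predT iter_addr_0.
rewrite sz.
suff : \sum_(x <- sphere n) u x = (\sum_(x <- sphere n) 1) * u o /\
    \sum_(x <- sphere n.+1) u x = (\sum_(x <- sphere n.+1) 1) * u o by case.
elim: n => [|n [IH0 IH1]]; last by split=> //; rewrite !rec// IH0 IH1; ring.
have c0 w : real_harmonic w -> \sum_(x <- sphere 1) w x = q.+1%:R * w o.
  by move=> hw; rewrite hw sum_neighbours eqxx add0r big_sphereS /= big_seq1.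
by rewrite !c0// /= !big_seq1 mulr1 mul1r.
Qed.

Lemma size_sphere_ge n : (q ^ n <= size (sphere n))%N.
Proof.
elim: n => // n IHn /=; rewrite size_flatten /shape -map_comp sumnE big_map.
apply: leq_trans (_ : \sum_(p <- sphere n) q <= _)%N; last first.
  by apply: leq_sum => p _; rewrite /= size_children nsuccs_ge.
by rewrite big_const_seq count_predT iter_addn_0 expnS leq_mul2l IHn orbT.
Qed.

(** * The coefficients Gamma as functions of the last argument *)

Lemma sector_uniq y y' z : sector y z -> sector y' z -> lvl y = lvl y' -> y = y'.
Proof.
wlog: y y' / (exists k, iter k par y' = y) => [th|[k <-]].
  move=> /[dup] sy /(sectorE hX)[k ky] /[dup] sy' /(sectorE hX)[k' ky'] l.
  have [kk'|kk'] := leqP k' k.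
    apply: th => //; exists (k - k')%N; by rewrite -ky' -iterD subnK.
  apply/esym/th => //; exists (k' - k)%N.
  by rewrite -ky -iterD subnK// ltnW.
move=> _ _; have : sector (iter k par y') y' by apply/(sectorE hX); exists k.
by move=> /(sector_level hX)[//|] /[swap] ->; rewrite ltnn.
Qed.

Lemma Gamma_in v z x : [set z; x] `<=` sector v `\ v <->
  (sector v z /\ z <> v) /\ (sector v x /\ x <> v).
Proof.
split=> [h|[hz hx] y [->|->] //]; split; apply: h; by [left|right].
Qed.

(** The child c selects the branch at v that contains z; naming it expresses that
    z lies strictly below v, the only case in which Gamma(v, z, .) is not 0. *)
Section Branch.
Variables v c z : X.
Hypothesis cv : c \in children v.
Hypothesis cz : sector c z.

Let parc : par c = v. Proof. by move: cv; rewrite (mem_children hX) => /andP[_ /eqP]. Qed.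
Let co : c != o. Proof. by move: cv; rewrite (mem_children hX) => /andP[]. Qed.
Let lvlc : lvl c = (lvl v).+1. Proof. by rewrite -parc; have [] := parP hX co. Qed.

Let vz : sector v z.
Proof.
have [k kc] := (sectorE hX _ _ _).1 cz; apply/(sectorE hX).
by exists k.+1; rewrite iterS kc parc.
Qed.

Let zv : z <> v.
Proof.
move=> zv; have := sector_level hX cz; rewrite lvlc zv => -[h|].
  2: by rewrite ltnNge leqnSn.
by have := lvlc; rewrite -h => /n_Sn.
Qed.

Lemma Gamma_low x : (lvl x <= lvl v)%N -> Gam v z x = 0.
Proof.
move=> lx; rewrite /Gamma; case: asboolP => //= /Gamma_in[_ [sx xv]].
by have [//|] := sector_level hX sx; rewrite ltnNge lx.
Qed.

Lemma Gamma_child y : y \in children v ->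
  Gam v z y = (y == c)%:R - (nsuccs e o v)%:R^-1.
Proof.
move=> yv; have /andP[yo /eqP py] : (y != o) && (par y == v).
  by rewrite -(mem_children hX).
have ly : lvl y = (lvl v).+1 by rewrite -py; have [] := parP hX yo.
have ns : (nsuccs e o v)%:R != 0 :> R.
  by rewrite pnatr_eq0 -lt0n; apply: leq_trans (nsuccs_ge hX o v); apply: leq_trans hq.
have succ w : succs e o v w <-> w \in children v.
  by rewrite (mem_children hX) (succsE hX).
rewrite /Gamma; case: asboolP => [_|]; last first.
  case; apply/Gamma_in; split=> //; split; last first.
    by move=> yv'; move: ly; rewrite yv' => /n_Sn.
  by apply/(sector_par hX); right; rewrite py; exact: (sector_refl hX).
case: asboolP => [[w /succ wv wS]|h] /=; last first.
  case: eqP => [yc|_]; last by rewrite sub0r.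
  case: h; exists c; first exact/succ.
  by move=> _ [->|->] //; rewrite yc; exact: (sector_refl hX).
have lw : lvl w = (lvl v).+1.
  by move/succ: wv => -[].
have wy : w = y.
  apply/esym/(@sector_uniq y w y) => //; last by rewrite ly lw.
  by apply: wS; right.
have wc : w = c.
  by apply: (@sector_uniq w c z) => //; [apply: wS; left|rewrite lw lvlc].
by rewrite -wy -wc eqxx mulrBl divff// mul1r.
Qed.

(** With [Gamma_low] and [Gamma_child], this determines Gamma(v, z, .): it
    vanishes up to level |v|, has mean zero on the children of v, and is
    inherited from the parent everywhere else. *)
Lemma Gamma_par y : y != o -> par y <> v -> Gam v z y = Gam v z (par y).
Proof.
move=> yo pv; have [_ ly] := parP hX yo.
have E : ([set z; y] `<=` sector v `\ v) = ([set z; par y] `<=` sector v `\ v).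
  apply/propext; split=> /Gamma_in[hz [sy yv]]; apply/Gamma_in; split=> //; split=> //.
    by case/(sector_par hX): sy.
  by apply/(sector_par hX); right.
  move=> yv'; have [//|] := sector_level hX sy.
  by rewrite -yv' ly ltnNge leqnSn.
rewrite /Gamma E; case: asboolP => //= _.
suff -> : (exists2 w, succs e o v w & [set z; y] `<=` sector w) =
   (exists2 w, succs e o v w & [set z; par y] `<=` sector w) by [].
apply/propext; split=> -[w wv wS]; exists w => // x [->|->]; try by apply: wS; left.
  case/(sector_par hX): (wS y (or_intror erefl)) => // yw.
  by case: pv; move: wv; rewrite -yw (succsE hX) => /andP[_ /eqP].
by apply/(sector_par hX); right; apply: wS; right.
Qed.


Definition oscillation (u : X -> R) : R :=
  u c - (nsuccs e o v)%:R^-1 * \sum_(y <- children v) u y.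

Lemma Gamma_children u :
  \sum_(y <- children v) Gam v z y * u y = oscillation u.
Proof.
rewrite big_seq; under eq_bigr => y yv do rewrite Gamma_child// mulrBl.
rewrite -big_seq sumrB -mulr_sumr; congr (_ - _).
rewrite (bigD1_seq c) ?children_uniq//= eqxx mul1r big1 ?addr0// => y /negPf ->.
by rewrite mul0r.
Qed.

(** One formula for all r: at v both sides vanish, because Gamma has mean zero on
    the children of v; at the root, which has q + 1 children, both sides vanish
    unless r = v; elsewhere there are q children, all with the value at r. *)
Lemma Gamma_sum r : \sum_(y <- children r) Gam v z y = Q * Gam v z r.
Proof.
have [->|/eqP rv] := eqVneq r v.
  rewrite Gamma_low// mulr0; have := Gamma_children (fun=> 1).
  under eq_bigr do rewrite mulr1.
  move=> ->; rewrite /oscillation big_const_seq count_predT iter_addr_0.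
  rewrite size_children mulVf ?subrr// pnatr_eq0 -lt0n.
  exact: leq_trans (ltnW hq) (nsuccs_ge hX o v).
rewrite big_seq; under eq_bigr => y.
  rewrite (mem_children hX) => /andP[yo /eqP yr].
  rewrite Gamma_par ?yr//; over.
rewrite -big_seq big_const_seq count_predT iter_addr_0 size_children.
have [r0|ro] := eqVneq r o; last by rewrite (nsuccs_other hX)// mulr_natl.
by rewrite r0 Gamma_low ?(level_root hX)// mul0rn mulr0.
Qed.

Definition branch (x : X) : R :=
  Gam v z x * (1 - Q ^ ((lvl v)%:Z - (lvl x)%:Z)).

(** By [Gamma_sum] the equation at x reduces to the identity
    (q + 1)(1 - t) = q (1 - t / q) + (1 - t q), with t = q^(|v| - |x|). When the
    parent of x is v, where Gamma is 0 and not inherited by x, the factor 1 - t q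
    vanishes as well, so that no separate case arises. *)
Lemma branch_harmonic : real_harmonic branch.
Proof.
move=> x; rewrite sum_neighbours.
set t := Q ^ ((lvl v)%:Z - (lvl x)%:Z).
have -> : \sum_(y <- children x) branch y = Q * Gam v z x * (1 - t / Q).
  rewrite -Gamma_sum mulr_suml !big_seq; apply: eq_bigr => y.
  rewrite (mem_children hX) => /andP[yo /eqP yx]; rewrite /branch.
  have [_ ->] := parP hX yo; rewrite yx; congr (_ * (1 - _)).
  by rewrite -addn1 PoszD opprD addrA expfzDr ?q_neq0.
have -> : (if x == o then 0 else branch (par x)) = Gam v z x * (1 - t * Q).
  have [->|xo] := eqVneq x o; first by rewrite Gamma_low ?(level_root hX)// mul0r.
  rewrite /branch.
  have -> : Q ^ ((lvl v)%:Z - (lvl (par x))%:Z) = t * Q.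
    rewrite /t; have [_ ->] := parP hX xo.
    rewrite -[X in _ * X]expr1z -expfzDr ?q_neq0//; congr (_ ^ _).
    by rewrite -addn1 PoszD opprD addrA subrK.
  have [pv|/eqP pv] := eqVneq (par x) v; last by rewrite -Gamma_par.
  have [_] := parP hX xo; rewrite pv => lx.
  by rewrite /t lx -addn1 PoszD opprD addrA subrr add0r mulVf ?q_neq0// subrr !mulr0.
rewrite /branch -/t mulrS; have := q_neq0; move: t (Gam _ _ _) => t g q0.
by field.
Qed.

Definition sphere_pairing (u : X -> R) n := \sum_(x <- sphere n) Gam v z x * u x.

Lemma sphere_pairing_low u n : (n <= lvl v)%N -> sphere_pairing u n = 0.
Proof.
move=> nv; rewrite /sphere_pairing big_seq big1// => x.
by rewrite (mem_sphere hX) => /eqP xn; rewrite Gamma_low ?xn// mul0r.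
Qed.

Lemma sphere_pairing_first u : sphere_pairing u (lvl v).+1 = oscillation u.
Proof.
rewrite /sphere_pairing big_sphereS (bigD1_seq v) ?(sphere_uniq hX) ?(mem_sphere hX)//=.
rewrite Gamma_children big_seq_cond big1 ?addr0// => r.
rewrite (mem_sphere hX) => /andP[/eqP rv /eqP nrv]; rewrite big_seq big1// => y.
rewrite (mem_children hX) => /andP[yo /eqP yr].
by rewrite Gamma_par ?yr// Gamma_low ?rv// mul0r.
Qed.

(** The recursion A(n + 2) = (q + 1) A(n + 1) - q A(n) holds from level |v| on,
    where A = 0; its solutions are the multiples of 1 + q + ... + q^(m-1). *)
Lemma sphere_pairingE u m : real_harmonic u ->
  sphere_pairing u (lvl v + m)%N = (\sum_(0 <= k < m) Q ^+ k) * oscillation u.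
Proof.
move=> hu.
suff : sphere_pairing u (lvl v + m)%N = (\sum_(0 <= k < m) Q ^+ k) * oscillation u
  /\ sphere_pairing u (lvl v + m.+1)%N = (\sum_(0 <= k < m.+1) Q ^+ k) * oscillation u.
  by case.
elim: m => [|m [IH0 IH1]].
  rewrite addn0 addn1 sphere_pairing_low// sphere_pairing_first.
  by rewrite big_nat1 big_geq// mul0r expr0 mul1r.
split=> //; rewrite /sphere_pairing !addnS sphere_recursion//; last first.
  move=> p y; rewrite (mem_sphere hX) (mem_children hX) => /eqP lp /andP[yo /eqP yp].
  rewrite Gamma_par ?yp// => pv; move: lp; rewrite pv.
  by move=> /eqP; rewrite -addnS -[X in X == _]addn0 eqn_add2l.
under [X in _ - X]eq_bigr do rewrite Gamma_sum -mulrA.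
rewrite -mulr_sumr -!/(sphere_pairing u _) -addnS IH0 IH1.
by rewrite !big_nat_recr//= mulrS !exprS; ring.
Qed.

End Branch.
End Harmonic.

(** * Summation by spheres *)

Lemma nneseries_fine_cvg (R : realType) (a : nat -> R) (m : nat) :
  (forall n, 0 <= a n) -> (\sum_(m <= n <oo) (a n)%:E < +oo)%E ->
  (fun N => \sum_(m <= n < N) a n) @ \oo --> fine (\sum_(m <= n <oo) (a n)%:E)%E.
Proof.
move=> a0 afin.
have c : (fun N => (\sum_(m <= n < N) (a n)%:E)%E) @ \oo -->
    (\sum_(m <= n <oo) (a n)%:E)%E.
  by apply: is_cvg_nneseries => n _ _; rewrite lee_fin.
have fin : (\sum_(m <= n <oo) (a n)%:E)%E \is a fin_num.
  by rewrite ge0_fin_numE// nneseries_ge0// => n _ _; rewrite lee_fin.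
rewrite -(fineK fin) in c; apply: cvg_trans (fine_cvg c).
by apply: near_eq_cvg; apply: nearW => N /=; rewrite sumEFin.
Qed.

Lemma cvg_sum_seq (R : realType) (I : Type) (s : seq I) (f : I -> nat -> R)
    (l : I -> R) : (forall i, f i @ \oo --> l i) ->
  (fun N => \sum_(i <- s) f i N) @ \oo --> \sum_(i <- s) l i.
Proof.
move=> fl; elim: s => [|i s IHs].
  by under eq_fun do rewrite big_nil; rewrite big_nil; exact: cvg_cst.
under eq_fun do rewrite big_cons; rewrite big_cons.
by apply: cvgD; [exact: fl|exact: IHs].
Qed.

Section Spheres.
Variables (R : realType) (X : choiceType) (e : rel X) (q : nat).
Hypothesis hX : homogeneous_tree e q.
Variable o : X.
Local Notation sphere := (sphere e o).

(** The unordered sums that define the scalar product and the total mass become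
    limits of sums over balls, to which the computations on spheres apply. *)
Lemma esum_spheres (h : X -> R) : (forall x, 0 <= h x) ->
  (\esum_(x in [set: X]) (h x)%:E =
   \sum_(0 <= n <oo) (\sum_(x <- sphere n) h x)%:E)%E.
Proof.
move=> h0.
have -> : [set: X] = \bigcup_n [set` sphere n].
  apply/seteqP; split=> // x _; exists (level e o x) => //=.
  by rewrite (mem_sphere hX).
rewrite nneseries_sum_bigcup; last 2 first.
- move=> i j _ _ [x [/=]]; rewrite !(mem_sphere hX).
  by move=> /eqP -> /eqP.
- by move=> x; rewrite lee_fin.
apply: eq_eseriesr => n _; rewrite esum_fset//; last by move=> x _; rewrite lee_fin.
by rewrite -fsbig_seq ?(sphere_uniq hX)// sumEFin.
Qed.

Lemma esum_spheres_cvg (h : X -> R) : (forall x, 0 <= h x) ->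
  (\esum_(x in [set: X]) (h x)%:E < +oo)%E ->
  (fun N => \sum_(0 <= n < N) \sum_(x <- sphere n) h x) @ \oo -->
  fine (\esum_(x in [set: X]) (h x)%:E)%E.
Proof.
move=> h0; rewrite esum_spheres// => hfin; apply: nneseries_fine_cvg => // n.
by apply: sumr_ge0.
Qed.

Lemma rsum_spheres_cvg (f : X -> R) : summable [set: X] (EFin \o f) ->
  (fun N => \sum_(0 <= n < N) \sum_(x <- sphere n) f x) @ \oo --> rsum f.
Proof.
move=> sf.
have pE : (EFin \o f)^\+%E = EFin \o (fun x => Num.max (f x) 0).
  by apply/funext => x; rewrite funeposE /= EFin_max.
have nE : (EFin \o f)^\-%E = EFin \o (fun x => Num.max (- f x) 0).
  by apply/funext => x; rewrite funenegE /= EFin_max.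
have m0 (y : R) : 0 <= Num.max y 0 by rewrite le_max lexx orbT.
have cp : (\esum_(x in [set: X]) (Num.max (f x) 0)%:E < +oo)%E.
  apply: le_lt_trans (summable_funepos sf); apply: le_esum => x _.
  by rewrite pE /= lee_fin ler_norm.
have cn : (\esum_(x in [set: X]) (Num.max (- f x) 0)%:E < +oo)%E.
  apply: le_lt_trans (summable_funeneg sf); apply: le_esum => x _.
  by rewrite nE /= lee_fin ler_norm.
have {}cp := esum_spheres_cvg (fun x => m0 (f x)) cp.
have {}cn := esum_spheres_cvg (fun x => m0 (- f x)) cn.
rewrite /rsum pE nE /=.
apply: cvg_trans (cvgB cp cn); apply: near_eq_cvg; apply: nearW => N /=.
rewrite -[LHS]/(_ - _) -sumrB; apply: eq_bigr => n _; rewrite -sumrB.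
apply: eq_bigr => x _; have [h|h] := leP (f x) 0.
  by rewrite max_l ?oppr_ge0// sub0r opprK.
by rewrite max_r ?subr0// oppr_le0 ltW.
Qed.

End Spheres.

Section Kernel.
Variables (R : realType) (X : choiceType) (e : rel X) (q : nat).
Hypothesis hX : homogeneous_tree e q.
Hypothesis hq : (2 <= q)%N.
Variables (o : X) (sigma : X -> R).
Hypothesis hsigma : reference_measure e o sigma.

Local Notation lvl := (level e o).
Local Notation par := (par e o).
Local Notation children := (children e o).
Local Notation sphere := (sphere e o).
Local Notation sector := (sector e o).
Local Notation Q := (q%:R : R).
Local Notation Gam := (Gamma e o R).
Local Notation sig := (sigma_at e o sigma).
Local Notation B := (total_mass sigma).
Local Notation b := (b_ e q o sigma).
Local Notation a := (a_ R q).
Local Notation ball_sum N f := (\sum_(0 <= n < N) \sum_(x <- sphere n) f x).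

Let q0 : Q != 0 := q_neq0 R hq.
Let qgt0 : 0 < Q := q_gt0 R hq.
Let qgt1 : 1 < Q := q_gt1 R hq.

Lemma sigma_level x : sigma x = sig (lvl x).
Proof.
apply: (ref_radial hsigma); rewrite /sigma_at.
by have -> // : [set y | lvl y = lvl x] (xget o [set y | lvl y = lvl x]);
  apply: xgetPex; exists x.
Qed.

Lemma sig_gt0 n : 0 < sig n. Proof. exact: (ref_gt0 hsigma). Qed.

Lemma sum_sphere_sigma n : \sum_(x <- sphere n) sigma x = sig n * (size (sphere n))%:R.
Proof.
rewrite big_seq; under eq_bigr => x.
  by rewrite (mem_sphere hX) => /eqP xn; rewrite sigma_level xn; over.
by rewrite -big_seq big_const_seq count_predT iter_addr_0 mulr_natr.
Qed.

Lemma mass_cvg : (fun N => ball_sum N sigma) @ \oo --> B.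
Proof.
apply: (esum_spheres_cvg hX); first by move=> x; exact/ltW/(ref_gt0 hsigma).
exact: (ref_finite hsigma).
Qed.

Lemma ball_sum_nd (h : X -> R) N M : (forall x, 0 <= h x) -> (N <= M)%N ->
  ball_sum N h <= ball_sum M h.
Proof.
move=> h0 NM; rewrite (@big_cat_nat _ _ _ N 0 M)//= lerDl.
by apply: sumr_ge0 => n _; apply: sumr_ge0.
Qed.

Lemma ball_sum_le_mass N : ball_sum N sigma <= B.
Proof.
rewrite -(cvg_lim _ mass_cvg)//.
apply: (@nondecreasing_cvgn_le _ (fun N => ball_sum N sigma)).
  by move=> n m; apply: ball_sum_nd => x; exact/ltW/(ref_gt0 hsigma).
by apply/cvg_ex; exists B; exact: mass_cvg.
Qed.

Lemma mass_gt0 : 0 < B.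
Proof.
apply: lt_le_trans (ball_sum_le_mass 1).
by rewrite big_nat1 /= big_seq1 (ref_gt0 hsigma).
Qed.

(** * The constants b *)

Lemma aE n : (1 - Q^-1) * a n = 1 - (Q ^+ n.+1)^-1.
Proof.
rewrite /a_; elim: n => [|n IHn]; first by rewrite big_nat1 expr0 invr1 mulr1 expr1.
rewrite big_nat_recr//= mulrDr IHn [in RHS]exprS.
have := expf_neq0 n.+1 q0; move: (Q ^+ n.+1) => t t0.
by field; rewrite q0 t0.
Qed.

Lemma a_ge0 n : 0 <= a n.
Proof. by apply: sumr_ge0 => k _; rewrite invr_ge0 exprn_ge0// ltW. Qed.

Lemma a_le2 n : a n <= 2.
Proof.
have q2 : 2 <= Q by rewrite ler_nat.
have qh : Q^-1 <= 2^-1 by rewrite lef_pV2// posrE.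
have t0 : 0 <= (Q ^+ n.+1)^-1 by rewrite invr_ge0 exprn_ge0// ltW.
have a0 := a_ge0 n; have hE := aE n.
move: (Q^-1) ((Q ^+ n.+1)^-1) (a n) qh t0 a0 hE => y t x qh t0 a0 hE.
have : 0 <= x * (2^-1 - y) by rewrite mulr_ge0// subr_ge0.
nra.
Qed.

Lemma geometric_le n : \sum_(0 <= k < n) Q ^+ k <= Q ^+ n.
Proof.
elim: n => [|n IHn]; first by rewrite big_geq// expr0.
rewrite big_nat_recr//= exprS; have q2 : 2 <= Q by rewrite ler_nat.
have t0 : 0 <= Q ^+ n by rewrite exprn_ge0// ltW.
apply: (@le_trans _ _ (2 * Q ^+ n)); first by rewrite mulr_natl mulr2n lerD2r.
by rewrite ler_wpM2r.
Qed.

Definition b_term n m : R :=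
  sig m * a (m - n - 1)%N * \sum_(0 <= k < (m - n - 1).+1) Q ^+ k.

Lemma b_term_ge0 n m : 0 <= b_term n m.
Proof.
apply: mulr_ge0; first by rewrite mulr_ge0 ?a_ge0// ltW// sig_gt0.
by apply: sumr_ge0 => k _; rewrite exprn_ge0// ltW.
Qed.

(** As a <= 2 and 1 + q + ... + q^(k-1) <= q^k, the series b is dominated by twice
    the mass of the spheres, whence its convergence. *)
Lemma b_term_le n m : (n < m)%N -> b_term n m <= 2 * \sum_(x <- sphere m) sigma x.
Proof.
move=> nm; rewrite sum_sphere_sigma /b_term mulrCA -mulrA.
apply: ler_wpM2l; first exact/ltW/sig_gt0.
apply: ler_pM (a_le2 _) _; rewrite ?a_ge0//.
  by apply: sumr_ge0 => k _; rewrite exprn_ge0// ltW.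
apply: le_trans (geometric_le _) _.
apply: (@le_trans _ _ (Q ^+ m)).
  by apply: ler_weXn2l; [exact: ltW|rewrite -subnDA addn1 subnSK// leq_subr].
by rewrite -natrX ler_nat (size_sphere_ge hX).
Qed.

Lemma b_fin n : (\sum_(n.+1 <= m <oo) (b_term n m)%:E < +oo)%E.
Proof.
apply: (@le_lt_trans _ _ (2 * B)%:E); last exact: ltry.
apply: lime_le.
  by apply: is_cvg_nneseries => m _ _; rewrite lee_fin b_term_ge0.
apply: nearW => N; rewrite sumEFin lee_fin.
apply: (@le_trans _ _ (2 * ball_sum N sigma)); last first.
  by rewrite ler_pM2l// ball_sum_le_mass.
rewrite mulr_sumr; have [Nn|nN] := leqP N n.+1.
  rewrite big_geq//; apply: sumr_ge0 => k _; apply: mulr_ge0 => //.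
  by apply: sumr_ge0 => x _; exact/ltW/(ref_gt0 hsigma).
rewrite [leRHS](@big_cat_nat _ _ _ n.+1)//=; last exact: ltnW.
apply: ler_wpDl.
  apply: sumr_ge0 => k _; apply: mulr_ge0 => //.
  by apply: sumr_ge0 => x _; exact/ltW/(ref_gt0 hsigma).
by apply: ler_sum_nat => m /andP[nm _]; exact: b_term_le.
Qed.

Lemma b_cvg n : (fun N => \sum_(n.+1 <= m < N) b_term n m) @ \oo --> b n.
Proof. by apply: nneseries_fine_cvg (b_fin n) => m; exact: b_term_ge0. Qed.

Lemma b_gt0 n : 0 < b n.
Proof.
have -> : b n = fine (\sum_(n.+1 <= m <oo) (b_term n m)%:E)%E by [].
have h m : (n < m)%N -> true -> (0 <= (b_term n m)%:E)%E by rewrite lee_fin b_term_ge0.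
rewrite -lte_fin fineK; last by rewrite ge0_fin_numE ?b_fin// nneseries_ge0.
apply: (@lt_le_trans _ _ (\sum_(n.+1 <= m < n.+2) (b_term n m)%:E)%E).
  rewrite big_nat1 lte_fin /b_term subSnn subnn /a_ !big_nat1 expr0 invr1.
  by rewrite !mulr1 sig_gt0.
by apply: nneseries_lim_ge => m; exact: h.
Qed.

(** * The reproducing property for real functions *)

Section Branch.
Variables v c z : X.
Hypothesis cv : c \in children v.
Hypothesis cz : sector c z.

(** On the sphere of radius |v| + m + 1 the radial factor of the branch is
    1 - q^(-m-1) = (1 - 1/q) a_m, and the rest of the sum is given by
    [sphere_pairingE]: their product with sigma is the general term of b. *)
Lemma ball_sum_branch u N : real_harmonic e q o u ->
  ball_sum N (fun x => u x * branch R e q o v z x * sigma x) =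
  (1 - Q^-1) * oscillation e o v c u * \sum_((lvl v).+1 <= m < N) b_term (lvl v) m.
Proof.
move=> hu; elim: N => [|N IHN]; first by rewrite !big_geq// mulr0.
rewrite big_nat_recr//= IHN.
have -> : \sum_(x <- sphere N) u x * branch R e q o v z x * sigma x =
    (1 - Q ^ ((lvl v)%:Z - N%:Z)) * sig N * sphere_pairing e o v z u N.
  rewrite mulr_sumr !big_seq; apply: eq_bigr => x.
  rewrite (mem_sphere hX) => /eqP xN; rewrite sigma_level xN /branch xN; ring.
have [Nv|vN] := leqP N (lvl v).
  by rewrite (sphere_pairing_low hX)// !big_geq ?mulr0 ?addr0// ltnW.
rewrite [in RHS]big_nat_recr//= [RHS]mulrDr; congr (_ + _).
have -> : N = (lvl v + (N - lvl v - 1).+1)%N by rewrite addnS -addSn -subnDA addn1 subnKC.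
move: (N - lvl v - 1)%N => m.
rewrite (sphere_pairingE hX hq cv cz)// /b_term.
have -> : (lvl v + m.+1 - lvl v - 1 = m)%N by rewrite addKn subn1.
have -> : Q ^ ((lvl v)%:Z - (lvl v + m.+1)%N%:Z) = (Q ^+ m.+1)^-1.
  by rewrite PoszD opprD addrA subrr add0r -exprnN.
by rewrite -aE; ring.
Qed.

End Branch.

(** Harmonicity at v eliminates the children of v. At the root there is no lower
    neighbour but one more child; the convention [par o = o] makes the second
    term vanish there, so that both cases read the same. *)
Lemma oscillationE u v c : real_harmonic e q o u ->
  oscillation e o v c u = (u c - u v) - (u v - u (par v)) / Q.
Proof.
move=> hu; have := hu v; rewrite sum_neighbours mulrS mulrDl mul1r /oscillation.
have [->|vo] := eqVneq v o.
  rewrite add0r par_root subrr mul0r subr0 => <-; rewrite (nsuccs_root hX).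
  have -> : u o + Q * u o = q.+1%:R * u o by rewrite mulrS mulrDl mul1r.
  by rewrite mulKf// pnatr_eq0.
rewrite (nsuccs_other hX)// => h.
have -> : \sum_(y <- children v) u y = u v + Q * u v - u (par v).
  by rewrite h addrAC subrr add0r.
by field.
Qed.

(** Along the path w from z down to the root, the increment w_k - w_(k+1)
    occurs in the terms of index k and k - 1, with total coefficient
    1 - q^(-k-1) - (1 - q^(-k)) / q = 1 - 1/q. *)
Lemma telescoping (w : nat -> R) n :
  \sum_(0 <= k < n) (1 - (Q ^+ k.+1)^-1) *
     ((w k - w k.+1) - (w k.+1 - w k.+2) / Q) =
  (1 - Q^-1) * (w 0%N - w n) - (1 - (Q ^+ n)^-1) / Q * (w n - w n.+1).
Proof.
elim: n => [|n IHn].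
  by rewrite big_geq// expr0 invr1 !subrr !mul0r mulr0 subrr.
rewrite big_nat_recr//= IHn [Q ^+ n.+1]exprS.
have := expf_neq0 n q0; move: (Q ^+ n) => t t0.
by field; rewrite q0 t0.
Qed.

Lemma ancestor_child z k : (k < lvl z)%N ->
  iter k par z \in children (iter k.+1 par z).
Proof.
move=> kz; rewrite (mem_children hX) eqxx andbT -(level_eq0 hX).
by rewrite (level_iter_par hX) subn_eq0 -ltnNge.
Qed.

Lemma sector_ancestor z k : sector (iter k par z) z.
Proof. by apply/(sectorE hX); exists k. Qed.

Lemma Gamma_ancestor v z x : Gam v z x != 0 ->
  exists2 k, (k < lvl z)%N & v = iter k.+1 par z.
Proof.
rewrite /Gamma; case: asboolP => [/(Gamma_in)[[vz zv] _] _|]; last by rewrite eqxx.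
have [//|lvz] := sector_level hX vz.
have /(sectorE hX)[k kv] := vz.
exists (lvl z - lvl v).-1.
  by rewrite prednK ?subn_gt0// leq_subr.
rewrite prednK ?subn_gt0//; apply: (sector_uniq hX vz (@sector_ancestor z _)).
by rewrite (level_iter_par hX) subKn// ltnW.
Qed.

Definition kernel (z x : X) : R :=
  B^-1 + Q ^+ 2 / (Q - 1) ^+ 2
     * \sum_(v \in [set: X])
         ((b (lvl v))^-1 * Gam v z x
          * (1 - Q ^ ((lvl v)%:Z - (lvl z)%:Z))
          * (1 - Q ^ ((lvl v)%:Z - (lvl x)%:Z))).

Lemma kernelC z x : kernel z x = kernel x z.
Proof.
congr (_ + _ * _); apply: eq_fsbigr => v _.
by rewrite /Gamma setUC mulrAC.
Qed.

(** Only the strict ancestors of z contribute. *)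
Lemma kernelE z x : kernel z x = B^-1 + Q ^+ 2 / (Q - 1) ^+ 2 *
  \sum_(0 <= k < lvl z) (b (lvl (iter k.+1 par z)))^-1 * (1 - (Q ^+ k.+1)^-1)
    * branch R e q o (iter k.+1 par z) z x.
Proof.
congr (_ + _ * _).
pose s := [seq iter k.+1 par z | k <- index_iota 0 (lvl z)].
rewrite -(@fsbig_widen _ _ _ _ [set` s])//=; last first.
  move=> v [_ /= vs]; have [g0|/Gamma_ancestor[k kz vk]] := eqVneq (Gam v z x) 0.
    by rewrite g0 mulr0 !mul0r.
  case: vs; apply/mapP; exists k => //; first by rewrite mem_index_iota.
have us : uniq s.
  rewrite map_inj_in_uniq ?iota_uniq// => i j; rewrite !mem_index_iota /= => iz jz.
  move=> /(congr1 lvl); rewrite -!iterS !(level_iter_par hX) => h.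
  by apply: succn_inj; rewrite -(subKn iz) h subKn.
rewrite -fsbig_seq// /s big_map big_nat [RHS]big_nat; apply: eq_bigr => k /andP[_ kz].
rewrite /branch.
have -> : Q ^ ((lvl (iter k.+1 par z))%:Z - (lvl z)%:Z) = (Q ^+ k.+1)^-1.
  by rewrite (level_iter_par hX) -subzn// addrAC subrr add0r exprnN.
by rewrite -!mulrA; congr (_ * _); rewrite mulrCA.
Qed.

Lemma real_harmonic_cst (r : R) : real_harmonic e q o (fun=> r).
Proof.
by move=> v; rewrite big_const_seq count_predT iter_addr_0 (size_neighbours hX) mulr_natl.
Qed.

Lemma kernel_harmonic z : real_harmonic e q o (kernel z).
Proof.
move=> v; under eq_bigr do rewrite kernelE.
rewrite big_split -real_harmonic_cst kernelE mulrDr; congr (_ + _).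
rewrite -mulr_sumr mulrCA; congr (_ * _).
rewrite exchange_big mulr_sumr /= big_nat [RHS]big_nat.
apply: eq_bigr => k /andP[_ kz]; rewrite -mulr_sumr mulrCA; congr (_ * _).
exact: (branch_harmonic R hX hq (ancestor_child kz) (@sector_ancestor z k)).
Qed.

Lemma Gamma_le1 v z x : `|Gam v z x| <= 1.
Proof.
have s1 : (1 <= nsuccs e o v)%N by apply: leq_trans (nsuccs_ge hX o v); exact: ltnW.
have s0 : 0 < (nsuccs e o v)%:R :> R by rewrite ltr0n.
rewrite /Gamma; case: ifP => _; first by rewrite normr0.
case: ifP => _; last by rewrite normrN ger0_norm ?invr_ge0 ?ler0n// invf_le1// ler1n.
rewrite ger0_norm; last by rewrite divr_ge0 ?ler0n// subr_ge0 ler1n.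
by rewrite ler_pdivrMr// mul1r gerBl.
Qed.

Lemma branch_le1 v z x : `|branch R e q o v z x| <= 1.
Proof.
rewrite /branch; have [xv|vx] := leqP (lvl x) (lvl v).
  by rewrite (Gamma_low R hX z xv) mul0r normr0.
rewrite normrM -[leRHS]mulr1; apply: ler_pM => //; first exact: Gamma_le1.
have -> : Q ^ ((lvl v)%:Z - (lvl x)%:Z) = (Q ^+ (lvl x - lvl v))^-1.
  by rewrite -opprB subzn ?exprnN// ltnW.
have t1 : 1 <= Q ^+ (lvl x - lvl v) by rewrite exprn_ege1// ltW.
have : 0 <= (Q ^+ (lvl x - lvl v))^-1 <= 1.
  by rewrite invr_ge0 (le_trans _ t1)//= invf_le1// (lt_le_trans _ t1).
by move=> /andP[i0 i1]; rewrite ger0_norm ?subr_ge0// gerBl.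
Qed.

Lemma kernel_bounded z : exists M : R, forall x, `|kernel z x| <= M.
Proof.
exists (`|B^-1| + `|Q ^+ 2 / (Q - 1) ^+ 2| * \sum_(0 <= k < lvl z)
  `|(b (lvl (iter k.+1 par z)))^-1 * (1 - (Q ^+ k.+1)^-1)|) => x.
rewrite kernelE; apply: le_trans (ler_normD _ _) _; rewrite lerD2l normrM.
apply: ler_wpM2l => //; apply: le_trans (ler_norm_sum _ _ _) _.
by apply: ler_sum => k _; rewrite normrM ler_piMr ?branch_le1.
Qed.

(** In the limit each ball sum against a branch produces b times an oscillation
    of u, so that the coefficient 1/b cancels; the oscillations then telescope
    along the path from z to o to u(z) - u(o), while the constant term of the
    kernel contributes u(o) by the mean value property. *)
Lemma kernel_reproduces_real u z : real_harmonic e q o u ->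
  summable [set: X] (EFin \o (fun x => u x * kernel z x * sigma x)) ->
  rsum (fun x => u x * kernel z x * sigma x) = u z.
Proof.
move=> hu su; rewrite -(cvg_lim _ (rsum_spheres_cvg hX o su))//; apply: cvg_lim => //.
pose cf k := (b (lvl (iter k.+1 par z)))^-1 * (1 - (Q ^+ k.+1)^-1).
pose osc k := oscillation e o (iter k.+1 par z) (iter k par z) u.
have -> : (fun N => ball_sum N (fun x => u x * kernel z x * sigma x)) =
    (fun N => B^-1 * u o * ball_sum N sigma + Q ^+ 2 / (Q - 1) ^+ 2 *
      \sum_(0 <= k < lvl z) cf k * ((1 - Q^-1) * osc k *
        \sum_((lvl (iter k.+1 par z)).+1 <= m < N)
          b_term (lvl (iter k.+1 par z)) m)).
  apply/funext => N.
  (* Both sides are compared pointwise once all sums over v are innermost. *)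
  under [X in _ + _ * X]eq_big_nat => k /andP[_ kz].
    rewrite -(ball_sum_branch (ancestor_child kz) (@sector_ancestor z k))//.
    rewrite mulr_sumr; under eq_bigr do rewrite mulr_sumr.
    over.
  rewrite exchange_big /= !mulr_sumr -big_split; apply: eq_bigr => n _ /=.
  rewrite exchange_big /= [X in _ + X]mulr_sumr.
  have -> : B^-1 * u o * \sum_(x <- sphere n) sigma x =
      \sum_(x <- sphere n) B^-1 * u x * sigma x.
    rewrite sum_sphere_sigma -mulrA.
    have -> : u o * (sig n * (size (sphere n))%:R) =
        sig n * \sum_(x <- sphere n) u x.
      by rewrite (sphere_sum_harmonic hX)//; ring.
    rewrite mulrA mulr_sumr !big_seq; apply: eq_bigr => x.
    by rewrite (mem_sphere hX) => /eqP xn; rewrite sigma_level xn; ring.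
  rewrite -big_split; apply: eq_bigr => x _ /=.
  rewrite kernelE mulrDr mulrDl; congr (_ + _); first by ring.
  rewrite mulrCA -mulrA; congr (_ * _); rewrite mulr_sumr mulr_suml.
  by apply: eq_bigr => k _; rewrite /cf; ring.
have -> : u z = B^-1 * u o * B + Q ^+ 2 / (Q - 1) ^+ 2 *
    \sum_(0 <= k < lvl z) cf k * ((1 - Q^-1) * osc k * b (lvl (iter k.+1 par z))).
  have B0 : B != 0 by rewrite gt_eqF ?mass_gt0.
  rewrite mulrAC mulVf// mul1r.
  pose w k := u (iter k par z).
  have -> : \sum_(0 <= k < lvl z) cf k * ((1 - Q^-1) * osc k * b (lvl (iter k.+1 par z)))
    = (1 - Q^-1) * \sum_(0 <= k < lvl z) (1 - (Q ^+ k.+1)^-1) *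
     ((w k - w k.+1) - (w k.+1 - w k.+2) / Q).
    rewrite mulr_sumr; apply: eq_bigr => k _.
    rewrite /osc oscillationE// /cf /w !iterS.
    have b0 : b (lvl (par (iter k par z))) != 0 by rewrite gt_eqF ?b_gt0.
    move: (b _) b0 => bb b0.
    rewrite -!mulrA mulrCA [RHS]mulrCA; congr (_ * _).
    by rewrite mulrCA [bb^-1 * _]mulrCA mulVf// mulr1.
  rewrite telescoping /w.
  have it : iter (lvl z) par z = o.
    by apply/eqP; rewrite -(level_eq0 hX) (level_iter_par hX) subnn.
  (* The boundary term of the telescoping sum vanishes because par o = o. *)
  rewrite iterS it par_root subrr mulr0 subr0 /=.
  have q1 : Q - 1 != 0 by rewrite subr_eq0 gt_eqF.
  by field; rewrite q0 q1.
apply: cvgD; first by apply: cvgMl_tmp; exact: mass_cvg.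
apply: cvgMl_tmp.
apply: cvg_sum_seq => k.
by apply: cvgMl_tmp; apply: cvgMl_tmp; exact: b_cvg.
Qed.

End Kernel.

(** * Complex functions and the scalar product *)

Section Complex.
Variables (R : realType) (X : choiceType) (e : rel X) (q : nat).
Hypothesis hX : homogeneous_tree e q.
Hypothesis hq : (2 <= q)%N.
Variables (o : X) (sigma : X -> R).
Hypothesis hsigma : reference_measure e o sigma.

Lemma conj_pair (x y : R) : ((x +i* y : R[i])^*)%R = x -i* y.
Proof. by []. Qed.

Lemma rsumN (T : choiceType) (f : T -> R) : rsum (fun x => - f x) = - rsum f.
Proof.
have -> : rsum (fun x => - f x) =
    fine (\esum_(x in [set: T]) ((EFin \o f)^\-)%E x)
    - fine (\esum_(x in [set: T]) ((EFin \o f)^\+)%E x).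
  rewrite /rsum; congr (fine _ - fine _); apply: eq_esum => x _.
    by rewrite funeposE funenegE /= EFinN.
  by rewrite funeposE funenegE /= opprK.
by rewrite /rsum opprB.
Qed.

Lemma inner_conj (f g : X -> R[i]) : inner sigma f g = (inner sigma g f)^*.
Proof.
rewrite /inner /csum conj_pair -rsumN.
congr Complex; congr rsum; apply/funext => x.
  case: (f x) (g x) => [f1 f2] [g1 g2]; rewrite !conj_pair /=; ring.
case: (f x) (g x) => [f1 f2] [g1 g2]; rewrite !conj_pair /=; ring.
Qed.

Lemma inner_real (g : X -> R[i]) (k : X -> R) :
  inner sigma g (fun x => (k x)%:C) =
  rsum (fun x => complex.Re (g x) * k x * sigma x)
  +i* rsum (fun x => complex.Im (g x) * k x * sigma x).
Proof.
rewrite /inner /csum; congr Complex; congr rsum; apply/funext => x;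
case: (g x) => [g1 g2]; rewrite conj_pair /=; ring.
Qed.

Lemma ReD : {morph (@complex.Re R : R[i] -> R) : x y / x + y}.
Proof. by case=> a b [c d]. Qed.

Lemma ImD : {morph (@complex.Im R : R[i] -> R) : x y / x + y}.
Proof. by case=> a b [c d]. Qed.

Lemma Re_natM n (x : R[i]) : complex.Re (n%:R * x) = n%:R * complex.Re x.
Proof.
rewrite !mulr_natl; elim: n => [|n IHn]; first by rewrite !mulr0n.
by rewrite !mulrS ReD IHn.
Qed.

Lemma Im_natM n (x : R[i]) : complex.Im (n%:R * x) = n%:R * complex.Im x.
Proof.
rewrite !mulr_natl; elim: n => [|n IHn]; first by rewrite !mulr0n.
by rewrite !mulrS ImD IHn.
Qed.

Lemma harmonicE (f : X -> R[i]) : harmonic_fun e q f ->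
  forall v, q.+1%:R * f v = \sum_(y <- neighbours e o v) f y.
Proof.
move=> hf v; rewrite [in LHS]hf (neighboursE hX o) -fsbig_seq ?(neighbours_uniq hX)//.
by rewrite mulVKf// pnatr_eq0.
Qed.

Lemma harmonic_Re (f : X -> R[i]) : harmonic_fun e q f ->
  real_harmonic e q o (fun x => complex.Re (f x)).
Proof.
by move=> /harmonicE hf v; rewrite -Re_natM hf (big_morph _ ReD (erefl _)).
Qed.

Lemma harmonic_Im (f : X -> R[i]) : harmonic_fun e q f ->
  real_harmonic e q o (fun x => complex.Im (f x)).
Proof.
by move=> /harmonicE hf v; rewrite -Im_natM hf (big_morph _ ImD (erefl _)).
Qed.

Lemma harmonic_real (u : X -> R) : real_harmonic e q o u ->
  harmonic_fun e q (fun x => (u x)%:C).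
Proof.
move=> hu v; rewrite (neighboursE hX o) -fsbig_seq ?(neighbours_uniq hX)//.
have -> : \sum_(y <- neighbours e o v) (u y)%:C = (q.+1%:R * u v)%:C.
  by rewrite hu rmorph_sum.
by rewrite rmorphM rmorph_nat mulKf// pnatr_eq0.
Qed.

Lemma esumZ_fin (M : R) (h : X -> R) : 0 <= M -> (forall x, 0 <= h x) ->
  (\esum_(x in [set: X]) (h x)%:E < +oo)%E ->
  (\esum_(x in [set: X]) (M * h x)%:E < +oo)%E.
Proof.
move=> M0 h0; rewrite !(esum_spheres hX o)//; last by move=> x; exact: mulr_ge0.
move=> hfin; under eq_eseriesr => n _ do rewrite -mulr_sumr EFinM.
rewrite nneseriesZl ?lte_mul_pinfty// => n _.
by rewrite lee_fin sumr_ge0.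
Qed.

(** Since |u| <= 1 + u^2 and sigma is finite, square summability of u suffices. *)
Lemma summable_weighted (u k : X -> R) :
  (\esum_(x in [set: X]) (u x ^+ 2 * sigma x)%:E < +oo)%E ->
  (exists M, forall x, `|k x| <= M) ->
  summable [set: X] (EFin \o (fun x => u x * k x * sigma x)).
Proof.
move=> uf [M kM]; have M0 : 0 <= M := le_trans (normr_ge0 _) (kM o).
have s0 x : 0 <= sigma x := ltW (ref_gt0 hsigma x).
have ss0 x : 0 <= sigma x + u x ^+ 2 * sigma x.
  by rewrite addr_ge0// mulr_ge0// sqr_ge0.
apply: (@le_lt_trans _ _
    (\esum_(x in [set: X]) (M * (sigma x + u x ^+ 2 * sigma x))%:E)%E).
  apply: le_esum => x _ /=; rewrite lee_fin !normrM (ger0_norm (s0 x)).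
  rewrite mulrAC mulrC; apply: ler_pM => //; first by rewrite mulr_ge0.
  rewrite -[X in X + _]mul1r -mulrDl; apply: ler_wpM2r => //.
  rewrite -(real_normK (num_real (u x))); have := normr_ge0 (u x).
  move: `|u x| => t t0; nra.
apply: esumZ_fin => //; under eq_esum do rewrite EFinD.
rewrite esumD; last 2 first.
- by move=> x _; rewrite lee_fin.
- by move=> x _; rewrite lee_fin mulr_ge0// sqr_ge0.
by apply: lte_add_pinfty => //; exact: (ref_finite hsigma).
Qed.

Lemma bergman_Re (f : X -> R[i]) : bergman e q sigma f ->
  (\esum_(x in [set: X]) (complex.Re (f x) ^+ 2 * sigma x)%:E < +oo)%E.
Proof.
move=> [_]; apply: le_lt_trans; apply: le_esum => x _; rewrite lee_fin.
apply: ler_wpM2r; first exact/ltW/(ref_gt0 hsigma).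
case: (f x) => a b /=; rewrite sqr_sqrtr ?addr_ge0 ?sqr_ge0//.
by rewrite lerDl sqr_ge0.
Qed.

Lemma bergman_Im (f : X -> R[i]) : bergman e q sigma f ->
  (\esum_(x in [set: X]) (complex.Im (f x) ^+ 2 * sigma x)%:E < +oo)%E.
Proof.
move=> [_]; apply: le_lt_trans; apply: le_esum => x _; rewrite lee_fin.
apply: ler_wpM2r; first exact/ltW/(ref_gt0 hsigma).
case: (f x) => a b /=; rewrite sqr_sqrtr ?addr_ge0 ?sqr_ge0//.
by rewrite lerDr sqr_ge0.
Qed.

Lemma kernel_bergman z :
  bergman e q sigma (fun x => (kernel e q o sigma z x)%:C).
Proof.
split; first exact: (harmonic_real (kernel_harmonic hX hq o sigma z)).
have [M kM] := kernel_bounded hX hq o sigma z.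
have M0 : 0 <= M := le_trans (normr_ge0 _) (kM o).
have s0 x : 0 <= sigma x := ltW (ref_gt0 hsigma x).
apply: le_lt_trans (esumZ_fin (exprn_ge0 2 M0) s0 (ref_finite hsigma)).
apply: le_esum => x _; rewrite lee_fin; apply: ler_wpM2r => //=.
rewrite expr0n addr0 sqr_sqrtr ?sqr_ge0// -(real_normK (num_real _)).
by rewrite lerXn2r// nnegrE.
Qed.

Lemma kernel_reproduces (g : X -> R[i]) z : bergman e q sigma g ->
  inner sigma g (fun x => (kernel e q o sigma z x)%:C) = g z.
Proof.
move=> hg; have [harm _] := hg; rewrite inner_real.
have kb := kernel_bounded hX hq o sigma z.
rewrite (kernel_reproduces_real hX hq hsigma (harmonic_Re harm)); last first.
  exact: summable_weighted (bergman_Re hg) kb.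
rewrite (kernel_reproduces_real hX hq hsigma (harmonic_Im harm)); last first.
  exact: summable_weighted (bergman_Im hg) kb.
by case: (g z).
Qed.

End Complex.

Theorem theorem11 (R : realType) (q : nat) (hq : (2 <= q)%N)
    (X : choiceType) (e : rel X) (hX : homogeneous_tree e q) (o : X)
    (sigma : X -> R) (hsigma : reference_measure e o sigma)
    (K : X -> X -> R[i]) (hK : reproducing_kernel e q sigma K) (z x : X) :
  K z x =
  ((total_mass sigma)^-1
   + q%:R ^+ 2 / (q%:R - 1) ^+ 2
     * \sum_(v \in [set: X])
         ((b_ e q o sigma (level e o v))^-1
          * Gamma e o R v z x
          * (1 - q%:R ^ ((level e o v)%:Z - (level e o z)%:Z))
          * (1 - q%:R ^ ((level e o v)%:Z - (level e o x)%:Z))))%:C.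
Proof.
(* Writing k_x for the explicit kernel, K_z(x) = <K_z, k_x> because k_x
   reproduces K_z, and this is the conjugate of <k_x, K_z> = k_x(z), because K_z
   reproduces k_x; and k_x(z) is real and symmetric. *)
rewrite -[RHS]/((kernel e q o sigma z x)%:C) kernelC.
have [bK rK] := hK z.
rewrite -(kernel_reproduces hX hq hsigma x bK) inner_conj.
by rewrite (rK _ (kernel_bergman hX hq hsigma x)) conj_pair oppr0.
Qed.
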